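(* Let $\Bbbk$ be a field and $A$ a finite-dimensional $\Bbbk$-algebra. The $\Bbbk$-linear equivalence $F_A:\mathsf{Klcrep}(A)\to\mathsf{rep}(A)$ induces a bijection between the isomorphism classes of simple objects of $\mathsf{Klcrep}(A)$ and the isomorphism classes of simple left $A$-modules. Equivalently, a nonzero object $(X,\theta)$ of $\mathsf{Klcrep}(A)$ is simple if and only if the only subspaces $W\subseteq\Bbbk^{\oplus X}$ satisfying $\Phi_X(\theta(a))W\subseteq W$ for all $a\in A$ are $0$ and $\Bbbk^{\oplus X}$.
   Context: $A$ is associative with identity; $\mathsf{rep}(A)$ is the category of finite-dimensional left $A$-modules. Let $\mathbf 1=\{\bullet\}$, and for a finite set $X$ put $E_X=X\times X$. For a set $X$, $\mathcal M_{\Bbbk}(X)\cong\Bbbk^{\oplus X}$ is the $\Bbbk$-vector space of finite formal sums $\sum_{x\in X}a_x[x]$; $\mathscr M_{\Bbbk}$ is the corresponding free $\Bbbk$-module monad on $\mathsf{Set}$ (unit $x\mapsto[x]$, multiplication given by expanding formal sums of formal sums). A Kleisli arrow $f:X\rightsquigarrow Y$ is a map $f:X\to\mathcal M_{\Bbbk}(Y)$, $f(x)=\sum_y f_{y,x}[y]$, with matrix $[f]=(f_{y,x})$; Kleisli composition satisfies $[h\circ_{\mathsf{Kl}}f]=[h][f]$. For finite $X$, $\mathbb H_{\Bbbk}(X)=\mathrm{Hom}_{\mathsf{Kl}(\mathscr M_{\Bbbk})}(\mathbf 1,E_X)$ is a unital $\Bbbk$-algebra with pointwise linear structure and Kleisli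 convolution as multiplication: if $f(\bullet)=\sum f_{i,j}[(i,j)]$ and $g(\bullet)=\sum g_{i,j}[(i,j)]$ then $(f\ast g)(\bullet)=\sum_{i,q}(\sum_j f_{i,j}g_{j,q})[(i,q)]$; its unit is $u_X(\bullet)=\sum_x[(x,x)]$. $\Phi_X:\mathbb H_{\Bbbk}(X)\to\mathrm{Mat}_X(\Bbbk)$, $f\mapsto(f_{i,j})$, is an isomorphism of $\Bbbk$-algebras. A Kleisli convolution representation of $A$ is a pair $(X,\theta)$ with $X$ a finite set and $\theta:A\to\mathbb H_{\Bbbk}(X)$ a unital $\Bbbk$-algebra homomorphism. A homomorphism $(X,\theta_X)\to(Y,\theta_Y)$ is a Kleisli arrow $f:X\rightsquigarrow Y$ with $\Phi_Y(\theta_Y(a))[f]=[f]\Phi_X(\theta_X(a))$ for all $a\in A$. These form the $\Bbbk$-linear category $\mathsf{Klcrep}(A)$ under Kleisli composition. The functor $F_A$ sends $(X,\theta)$ to $\mathcal M_{\Bbbk}(X)$ with action $a\cdot v=\Phi_X(\theta(a))v$, and sends $f$ to the linear map $[x]\mapsto f(x)$; it is a $\Bbbk$-linear equivalence. A nonzero object $(X,\theta)$ of $\mathsf{Klcrep}(A)$ is called simple (a simple Kleisli convolution representation) if $F_A(X,\theta)$ is a simple left $A$-module. *)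

(* Defs.v *)
From HB Require Import structures.
From mathcomp Require Import all_boot all_order all_algebra all_field.
From mathcomp Require Import boolp classical_sets functions.

Set Implicit Arguments.
Unset Strict Implicit.
Unset Printing Implicit Defensive.

Import GRing.Theory.
Local Open Scope ring_scope.

(* MathComp's [algType] and [falgType] require [1 != 0], and no structure joins
   [lmodType] and [pzRingType]; this record also covers the zero algebra. *)
Record fdAlg (k : fieldType) := FdAlg {
  fdalg_vect : vectType k;
  fdalg_one : fdalg_vect;
  fdalg_mul : fdalg_vect -> fdalg_vect -> fdalg_vect;
  fdalg_mulA : associative fdalg_mul;
  fdalg_mul1r : left_id fdalg_one fdalg_mul;
  fdalg_mulr1 : right_id fdalg_one fdalg_mul;
  fdalg_mulDl : left_distributive fdalg_mul +%R;
  fdalg_mulDr : right_distributive fdalg_mul +%R;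
  fdalg_scaleAl : forall (c : k) x y,
    c *: fdalg_mul x y = fdalg_mul (c *: x) y;
  fdalg_scaleAr : forall (c : k) x y,
    c *: fdalg_mul x y = fdalg_mul x (c *: y)
}.

Definition fdalg_sort (k : fieldType) (A : fdAlg k) : Type := fdalg_vect A.
Coercion fdalg_sort : fdAlg >-> Sortclass.

HB.instance Definition _ (k : fieldType) (A : fdAlg k) :=
  Vector.on (fdalg_sort A).
HB.instance Definition _ (k : fieldType) (A : fdAlg k) :=
  GRing.Zmodule_isPzRing.Build (fdalg_sort A) (@fdalg_mulA k A)
    (@fdalg_mul1r k A) (@fdalg_mulr1 k A) (@fdalg_mulDl k A) (@fdalg_mulDr k A).

Definition fdalg_in (k : fieldType) (A : fdAlg k) (c : k) : A := c *: (1 : A).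

Section FdAlgTheory.
Variables (k : fieldType) (A : fdAlg k).
Implicit Types (b c : k) (x y : A).

Lemma fdalg_scalerAl c x y : c *: (x * y) = (c *: x) * y.
Proof. exact: fdalg_scaleAl. Qed.

Lemma fdalg_scalerAr c x y : c *: (x * y) = x * (c *: y).
Proof. exact: fdalg_scaleAr. Qed.

Lemma fdalg_inE c x : fdalg_in A c * x = c *: x.
Proof. by rewrite -fdalg_scalerAl mul1r. Qed.

Lemma fdalg_inC x c : x * fdalg_in A c = fdalg_in A c * x.
Proof. by rewrite fdalg_inE -fdalg_scalerAr mulr1. Qed.

Lemma fdalg_in0 : fdalg_in A 0 = 0. Proof. exact: scale0r. Qed.

Lemma fdalg_in1 : fdalg_in A 1 = 1. Proof. exact: scale1r. Qed.

Lemma fdalg_inD b c : fdalg_in A (b + c) = fdalg_in A b + fdalg_in A c.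
Proof. exact: scalerDl. Qed.

Lemma fdalg_inB b c : fdalg_in A (b - c) = fdalg_in A b - fdalg_in A c.
Proof. exact: scalerBl. Qed.

Lemma fdalg_inM b c : fdalg_in A (b * c) = fdalg_in A b * fdalg_in A c.
Proof. by rewrite fdalg_inE /fdalg_in scalerA. Qed.

End FdAlgTheory.

Definition fdalg_of_falgType (k : fieldType) (A : falgType k) : fdAlg k :=
  @FdAlg k A 1 *%R (@mulrA A) (@mul1r A) (@mulr1 A) (@mulrDl A) (@mulrDr A)
    (@scalerAl k A) (@scalerAr k A).

Section Kleisli.
Variable k : fieldType.
Implicit Types X Y Z : finType.

(* The formal sum \sum_x a_x [x] over a finite set is the family of its
   coefficients; every family is finitely supported. *)
Definition Mk X := {ffun X -> k^o}.

Definition kl_ret X (x : X) : Mk X := [ffun y => (y == x)%:R].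

Definition kl_bind X Y (v : Mk X) (f : X -> Mk Y) : Mk Y :=
  \sum_x (v x : k) *: f x.

Definition Kl X Y := {ffun X -> Mk Y}.

Definition kl_id X : Kl X X := [ffun x => kl_ret x].

Definition kl_comp X Y Z (h : Kl Y Z) (f : Kl X Y) : Kl X Z :=
  [ffun x => kl_bind (f x) h].

(* Matrices with rows and columns indexed by finite sets are MathComp matrices,
   through the enumerations of these sets. *)
Definition kl_mx X Y (f : Kl X Y) : 'M[k]_(#|Y|, #|X|) :=
  \matrix_(i, j) f (enum_val j) (enum_val i).

Definition Mk_col X (v : Mk X) : 'cV[k]_#|X| := \col_i v (enum_val i).

Definition col_Mk X (c : 'cV[k]_#|X|) : Mk X := [ffun x => c (enum_rank x) 0].

Definition Mk_mx X (P : 'M[k]_#|X|) (v : Mk X) : Mk X :=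
  col_Mk (P *m Mk_col v).

Definition Hk X := Kl unit (X * X)%type.

HB.instance Definition _ X := GRing.Lmodule.on (Hk X).

Definition kl_conv X (f g : Hk X) : Hk X :=
  [ffun _ => [ffun p => \sum_j (f tt (p.1, j) : k) * g tt (j, p.2)]].

Definition kl_convu X : Hk X := [ffun _ => \sum_x kl_ret (x, x)].

Lemma HkP X (f g : Hk X) :
  (forall i j, f tt (i, j) = g tt (i, j)) -> f = g.
Proof. by move=> fg; apply/ffunP => -[]; apply/ffunP => -[i j]. Qed.

Lemma kl_convE X (f g : Hk X) i j :
  kl_conv f g tt (i, j) = \sum_q (f tt (i, q) : k) * g tt (q, j).
Proof. by rewrite !ffunE. Qed.

Lemma kl_convuE X i j : kl_convu X tt (i, j) = (i == j)%:R.
Proof.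
rewrite ffunE sum_ffunE (bigD1 i) //= big1 => [|x xi]; rewrite ffunE.
  by rewrite addr0 xpair_eqE eqxx eq_sym.
by rewrite xpair_eqE (eq_sym i) (negPf xi).
Qed.

Fact kl_convA X : associative (@kl_conv X).
Proof.
move=> f g h; apply: HkP => i j; rewrite !kl_convE.
under eq_bigr do rewrite kl_convE mulr_sumr.
rewrite exchange_big; apply: eq_bigr => q _.
by rewrite kl_convE mulr_suml; apply: eq_bigr => r _; rewrite mulrA.
Qed.

Fact kl_conv1l X : left_id (kl_convu X) (@kl_conv X).
Proof.
move=> f; apply: HkP => i j; rewrite kl_convE (bigD1 i) //= big1 => [|q qi].
  by rewrite kl_convuE eqxx mul1r addr0.
by rewrite kl_convuE eq_sym (negPf qi) mul0r.
Qed.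

Fact kl_conv1r X : right_id (kl_convu X) (@kl_conv X).
Proof.
move=> f; apply: HkP => i j; rewrite kl_convE (bigD1 j) //= big1 => [|q qi].
  by rewrite kl_convuE eqxx mulr1 addr0.
by rewrite kl_convuE (negPf qi) mulr0.
Qed.

Fact kl_convDl X : left_distributive (@kl_conv X) +%R.
Proof.
move=> f g h; apply: HkP => i j; rewrite kl_convE !ffunE -big_split.
by apply: eq_bigr => q _; rewrite !ffunE mulrDl.
Qed.

Fact kl_convDr X : right_distributive (@kl_conv X) +%R.
Proof.
move=> f g h; apply: HkP => i j; rewrite kl_convE !ffunE -big_split.
by apply: eq_bigr => q _; rewrite !ffunE mulrDr.
Qed.

HB.instance Definition _ X := GRing.Zmodule_isPzRing.Build (Hk X)
  (@kl_convA X) (@kl_conv1l X) (@kl_conv1r X) (@kl_convDl X) (@kl_convDr X).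

Fact Hk_scalerAl X (c : k) (f g : Hk X) : c *: (f * g) = (c *: f) * g.
Proof.
apply: HkP => i j; rewrite kl_convE !ffunE scaler_sumr.
by apply: eq_bigr => q _; rewrite !ffunE /GRing.scale /= mulrA.
Qed.

Fact Hk_scalerAr X (c : k) (f g : Hk X) : c *: (f * g) = f * (c *: g).
Proof.
apply: HkP => i j; rewrite kl_convE !ffunE scaler_sumr.
by apply: eq_bigr => q _; rewrite !ffunE /GRing.scale /= mulrCA.
Qed.

Lemma Hk1E X i j : (1 : Hk X) tt (i, j) = (i == j)%:R.
Proof. exact: kl_convuE. Qed.

Lemma HkME X (f g : Hk X) i j :
  (f * g) tt (i, j) = \sum_q (f tt (i, q) : k) * g tt (q, j).
Proof. exact: kl_convE. Qed.

Definition Phi X (f : Hk X) : 'M[k]_#|X| :=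
  \matrix_(i, j) f tt (enum_val i, enum_val j).

Lemma sum_enum_val X (V : nmodType) (F : X -> V) :
  \sum_(i < #|X|) F (enum_val i) = \sum_x F x.
Proof. by rewrite [RHS](reindex _ (onW_bij _ (enum_val_bij X))). Qed.

Lemma PhiM X (f g : Hk X) : Phi (f * g) = Phi f *m Phi g.
Proof.
apply/matrixP => i j; rewrite !mxE kl_convE -sum_enum_val.
by apply: eq_bigr => q _; rewrite !mxE.
Qed.

Lemma Phi1 X : Phi (1 : Hk X) = 1%:M.
Proof.
by apply/matrixP => i j; rewrite !mxE kl_convuE (inj_eq enum_val_inj).
Qed.

Lemma Phi_linear X : linear (@Phi X).
Proof. by move=> c f g; apply/matrixP => i j; rewrite !mxE !ffunE. Qed.

Lemma Phi_bij X : bijective (@Phi X).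
Proof.
exists (fun P : 'M_#|X| =>
  [ffun _ => [ffun p => P (enum_rank p.1) (enum_rank p.2)]] : Hk X).
  by move=> f; apply: HkP => i j; rewrite !ffunE mxE !enum_rankK.
by move=> P; apply/matrixP => i j; rewrite mxE !ffunE !enum_valK.
Qed.

Lemma kl_mx_comp X Y Z (h : Kl Y Z) (f : Kl X Y) :
  kl_mx (kl_comp h f) = kl_mx h *m kl_mx f.
Proof.
apply/matrixP => i j; rewrite !mxE ffunE sum_ffunE -[LHS]sum_enum_val.
by apply: eq_bigr => q _; rewrite !mxE ffunE /GRing.scale /= mulrC.
Qed.

Lemma Mk_mxE X (f : Hk X) (v : Mk X) x :
  Mk_mx (Phi f) v x = \sum_y (f tt (x, y) : k) * v y.
Proof.
rewrite ffunE mxE -[RHS]sum_enum_val; apply: eq_bigr => j _.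
by rewrite !mxE enum_rankK.
Qed.

Lemma kl_bindE X Y (v : Mk X) (f : X -> Mk Y) y :
  kl_bind v f y = \sum_x (v x : k) * f x y.
Proof. by rewrite sum_ffunE; apply: eq_bigr => x _; rewrite ffunE. Qed.

End Kleisli.

Arguments Phi {k X} f.
Arguments kl_ret k {X} x.

Section Klcrep.
Variables (k : fieldType) (A : fdAlg k).

Record klcrep := Klcrep {
  kl_set : finType;
  kl_rep : {linear A -> Hk k kl_set};
  kl_rep_monoid_morphism : monoid_morphism kl_rep
}.

Implicit Types U V W : klcrep.

Definition is_klhom U V (f : Kl k (kl_set U) (kl_set V)) : Prop :=
  forall a : A, Phi (kl_rep V a) *m kl_mx f = kl_mx f *m Phi (kl_rep U a).

Definition klcrep_zero U : Prop :=
  forall V, (exists! f, @is_klhom U V f) /\ (exists! f, @is_klhom V U f).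

Definition klcrep_iso U V : Prop :=
  exists (f : Kl k (kl_set U) (kl_set V)) (g : Kl k (kl_set V) (kl_set U)),
    [/\ is_klhom f, is_klhom g,
        kl_comp g f = kl_id k (kl_set U) & kl_comp f g = kl_id k (kl_set V)].

(* A left [A]-module is a [k]-vector space through [fdalg_in]. *)
Definition fin_dim_module (M : lmodType A) : Prop :=
  exists s : seq M, forall m : M,
    exists c : 'I_(size s) -> k, m = \sum_i fdalg_in A (c i) *: s`_i.

Record rep := Rep {
  rep_module :> lmodType A;
  rep_fin_dim : fin_dim_module rep_module
}.

Definition module_iso (M N : lmodType A) : Prop :=
  exists f : {linear M -> N}, bijective f.

(* Boolean predicates describe all subsets, by excluded middle. *)
Definition simple_module (M : lmodType A) : Prop :=
  (exists m : M, m != 0) /\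
  forall S : {pred M}, submod_closed S -> S =i pred1 0 \/ S =i predT.

(* The vector space of formal sums on the underlying set of [U], with the action
   of [A] prescribed by [U]. *)
Definition FA_sort U := Mk k (kl_set U).

HB.instance Definition _ U := GRing.Zmodule.on (FA_sort U).

Definition FA_scale U (a : A) (v : FA_sort U) : FA_sort U :=
  Mk_mx (Phi (kl_rep U a)) v.

Lemma FA_scaleE U a (v : FA_sort U) x :
  FA_scale a v x = \sum_y (kl_rep U a tt (x, y) : k) * v y.
Proof. exact: Mk_mxE. Qed.

Fact FA_scaleA U a b (v : FA_sort U) :
  FA_scale a (FA_scale b v) = FA_scale (a * b) v.
Proof.
rewrite /FA_scale (kl_rep_monoid_morphism U) PhiM /Mk_mx -mulmxA.
congr (col_Mk (_ *m _)); apply/colP => i.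
by rewrite !mxE ffunE enum_valK !mxE.
Qed.

Fact FA_scale1 U : left_id 1 (@FA_scale U).
Proof.
move=> v; rewrite /FA_scale (kl_rep_monoid_morphism U) Phi1 /Mk_mx mul1mx.
by apply/ffunP => x; rewrite ffunE mxE enum_rankK.
Qed.

Fact FA_scaleDr U : right_distributive (@FA_scale U) +%R.
Proof.
move=> a u v; apply/ffunP => x; rewrite !(FA_scaleE, ffunE) -big_split.
by apply: eq_bigr => y _; rewrite ffunE mulrDr.
Qed.

Fact FA_scaleDl U (v : FA_sort U) :
  {morph (@FA_scale U)^~ v : a b / a + b}.
Proof.
move=> a b; apply/ffunP => x; rewrite !(FA_scaleE, ffunE) -big_split.
by apply: eq_bigr => y _; rewrite linearD !ffunE mulrDl.
Qed.

HB.instance Definition _ U := GRing.Zmodule_isLmodule.Build A (FA_sort U)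
  (@FA_scaleA U) (@FA_scale1 U) (@FA_scaleDr U) (@FA_scaleDl U).

Lemma FA_scalarE U (c : k) (v : FA_sort U) :
  fdalg_in A c *: v = (c *: (v : Mk k (kl_set U)) : Mk k (kl_set U)) :> FA_sort U.
Proof.
apply/ffunP => x; rewrite /fdalg_in FA_scaleE linearZ /= (kl_rep_monoid_morphism U).
rewrite (bigD1 x) //= big1 => [|y yx].
  by rewrite addr0 [in LHS]ffunE [in LHS]ffunE Hk1E eqxx !ffunE /GRing.scale /= mulr1.
by rewrite ffunE ffunE Hk1E eq_sym (negPf yx) scaler0 mul0r.
Qed.

Fact FA_fin_dim U : fin_dim_module (FA_sort U).
Proof.
exists [seq (kl_ret k x : FA_sort U) | x <- enum (kl_set U)] => v.
have sz : size [seq (kl_ret k x : FA_sort U) | x <- enum (kl_set U)]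
          = #|kl_set U| by rewrite size_map -cardE.
exists (fun i => v (enum_val (cast_ord sz i))).
rewrite (reindex (cast_ord (esym sz))) /=; last first.
  by apply: onW_bij; exists (cast_ord sz) => i; apply: val_inj.
apply/ffunP => x; rewrite sum_ffunE (bigD1 (enum_rank x)) //= big1 => [|i ix].
  rewrite FA_scalarE addr0 cast_ordKV enum_rankK ffunE.
  rewrite (nth_map x) -?cardE ?ltn_ord // nth_enum_rank.
  by rewrite ffunE eqxx /GRing.scale /= mulr1.
rewrite FA_scalarE ffunE (nth_map x) -?cardE ?ltn_ord // ffunE.
have -> : nth x (enum (kl_set U)) i = enum_val i.
  by rewrite (enum_val_nth x).
by rewrite -(inj_eq enum_val_inj) enum_rankK eq_sym in ix; rewrite (negPf ix) scaler0.
Qed.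

Definition FA U : rep := Rep (@FA_fin_dim U).

Definition FA_mor U V (f : Kl k (kl_set U) (kl_set V)) (v : FA U) : FA V :=
  kl_bind (v : Mk k (kl_set U)) f.

Lemma FA_morE U V f (v : FA U) y :
  (@FA_mor U V f v : Mk k _) y = \sum_x ((v : Mk k _) x : k) * f x y.
Proof. exact: kl_bindE. Qed.

Lemma FA_mor_col U V f (v : FA U) :
  Mk_col (@FA_mor U V f v : Mk k _) = kl_mx f *m Mk_col (v : Mk k _).
Proof.
apply/colP => i; rewrite !mxE FA_morE -[LHS]sum_enum_val.
by apply: eq_bigr => j _; rewrite !mxE mulrC.
Qed.

Lemma Mk_col_inj (X : finType) : injective (@Mk_col k X).
Proof.
move=> u v /colP uv; apply/ffunP => x.
by have := uv (enum_rank x); rewrite !mxE enum_rankK.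
Qed.

Lemma FA_scale_col U a (v : FA U) :
  Mk_col (a *: v : Mk k _) = Phi (kl_rep U a) *m Mk_col (v : Mk k _).
Proof. by apply/colP => i; rewrite mxE ffunE enum_valK. Qed.

Lemma FA_mor_id U (v : FA U) : FA_mor (V := U) (kl_id k _) v = v.
Proof.
apply/ffunP => x; rewrite FA_morE (bigD1 x) //= big1 => [|y yx].
  by rewrite !ffunE eqxx mulr1 addr0.
by rewrite !ffunE eq_sym (negPf yx) mulr0.
Qed.

Lemma FA_mor_comp U V W h f (v : FA U) :
  FA_mor (V := W) (kl_comp h f) v = FA_mor h (@FA_mor U V f v).
Proof. by apply: Mk_col_inj; rewrite !FA_mor_col kl_mx_comp mulmxA. Qed.

Lemma FA_mor_klinear U V (c : k) f g (v : FA U) :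
  @FA_mor U V (c *: f + g) v = fdalg_in A c *: FA_mor f v + FA_mor g v.
Proof.
rewrite FA_scalarE; apply/ffunP => y.
rewrite FA_morE [in RHS]ffunE [in RHS]ffunE !FA_morE scaler_sumr -big_split.
by apply: eq_bigr => x _; rewrite !ffunE mulrDr /GRing.scale /= mulrCA.
Qed.

Lemma FA_mor_additive U V f (u v : FA U) :
  @FA_mor U V f (u + v) = FA_mor f u + FA_mor f v.
Proof.
apply/ffunP => y; rewrite [in RHS]ffunE !FA_morE -big_split.
by apply: eq_bigr => x _; rewrite ffunE mulrDl.
Qed.

Lemma FA_mor_ret U V f x :
  @FA_mor U V f (kl_ret k x : FA_sort U) = f x.
Proof.
apply/ffunP => z; rewrite FA_morE (bigD1 x) //= big1 => [|y yx].
  by rewrite ffunE eqxx mul1r addr0.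
by rewrite ffunE (negPf yx) mul0r.
Qed.

Lemma is_klhomP U V f :
  is_klhom f <-> linear (@FA_mor U V f : FA U -> FA V).
Proof.
split=> [fhom a u v|flin a].
  rewrite FA_mor_additive; congr (_ + _); apply: Mk_col_inj.
  by rewrite FA_mor_col !FA_scale_col FA_mor_col !mulmxA fhom.
apply/matrixP => i j.
have Mcol P (Q : 'M[k]_(#|kl_set V|, #|kl_set U|)) :
    P = Q -> P i j = Q i j by move->.
have fscale (v : FA U) : FA_mor f (a *: v) = a *: FA_mor (V := V) f v.
  have := flin a v 0; rewrite addr0 => ->.
  by have := flin 0 0 0; rewrite !scale0r !add0r => f0;
     rewrite -[RHS]addr0; congr (_ + _); apply/ffunP => y;
     rewrite FA_morE ffunE big1 // => x _; rewrite ffunE mul0r.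
have := congr1 (fun v : FA V => Mk_col (v : Mk k _))
  (fscale (kl_ret k (enum_val j) : FA_sort U)).
rewrite FA_scale_col !FA_mor_col FA_scale_col !mulmxA.
have -> : Mk_col (kl_ret k (enum_val j)) = delta_mx j 0.
  by apply/colP => q; rewrite !mxE ffunE (inj_eq enum_val_inj) eqxx andbT.
by rewrite -!colE => /colP/(_ i); rewrite ![col _ _ _ _]mxE.
Qed.

Lemma is_klhom_id U : is_klhom (V := U) (kl_id k (kl_set U)).
Proof. by apply/is_klhomP => a u v; rewrite !FA_mor_id. Qed.

Lemma is_klhom_comp U V W h f :
  @is_klhom V W h -> @is_klhom U V f -> is_klhom (kl_comp h f).
Proof. by move=> hh fh a; rewrite kl_mx_comp mulmxA hh -!mulmxA fh. Qed.

Lemma FA_mor_faithful U V f g :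
  @FA_mor U V f =1 FA_mor g -> f = g.
Proof. by move=> fg; apply/ffunP => x; rewrite -!FA_mor_ret fg. Qed.

Lemma FA_sum_ret U (v : FA U) :
  v = \sum_x fdalg_in A ((v : Mk k _) x) *: (kl_ret k x : FA_sort U).
Proof.
apply/ffunP => y; rewrite sum_ffunE (bigD1 y) //= big1 => [|x xy].
  by rewrite FA_scalarE !ffunE eqxx addr0 /GRing.scale /= mulr1.
by rewrite FA_scalarE !ffunE eq_sym (negPf xy) scaler0.
Qed.

Lemma FA_mor_full U V (g : {linear FA U -> FA V}) :
  exists2 f, is_klhom f & @FA_mor U V f =1 g.
Proof.
pose f : Kl k (kl_set U) (kl_set V) :=
  [ffun x => (g (kl_ret k x : FA_sort U) : FA_sort V)].
have fg : @FA_mor U V f =1 g.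
  move=> v; rewrite {2}[v]FA_sum_ret linear_sum; apply/ffunP => y.
  rewrite FA_morE sum_ffunE; apply: eq_bigr => x _.
  by rewrite linearZ /= FA_scalarE !ffunE.
by exists f => //; apply/is_klhomP => a u v; rewrite !fg linearP.
Qed.

Lemma rep_basis (M : rep) : exists (n : nat) (b : 'I_n -> M), forall m : M,
  exists! c : Mk k 'I_n, m = \sum_i fdalg_in A (c i) *: b i.
Proof.
pose spans n (b : 'I_n -> M) := forall m : M, exists c : 'I_n -> k,
  m = \sum_i fdalg_in A (c i) *: b i.
have ex_n : exists n, `[< exists b, @spans n b >].
  have [s sP] := rep_fin_dim M; exists (size s); apply/asboolP.
  by exists (fun i => s`_i).
case: (ex_minnP ex_n) => n /asboolP[b bP] n_min.
exists n, b => m; have [c mE] := bP m; exists [ffun i => c i]; split.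
  by rewrite mE; apply: eq_bigr => i _; rewrite ffunE.
move=> d mE'; apply/eqP/contraT => /eqP/ffunP cd.
have [i /eqP ci] : exists i, c i <> d i.
  by apply: contrapT => /forallNP ncd; apply: cd => i; rewrite ffunE;
     apply: contrapT => /(ncd i).
case: n b bP n_min c d mE mE' i ci cd => [|n] b bP n_min c d mE mE' i ci _.
  by case: i ci.
pose e j := c j - d j.
have e0 : e i != 0 by rewrite subr_eq0.
have eb : \sum_j fdalg_in A (e j) *: b j = 0.
  under eq_bigr do rewrite fdalg_inB scalerBl.
  by rewrite sumrB -mE -mE' subrr.
have bi : b i = \sum_(j | j != i) fdalg_in A (- (e i)^-1 * e j) *: b j.
  have := congr1 (fun x => fdalg_in A (- (e i)^-1) *: x) eb.
  rewrite scaler0 (bigD1 i) //= scalerDr scalerA -fdalg_inM mulNr mulVf //.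
  rewrite -[-1]add0r fdalg_inB fdalg_in1 fdalg_in0 sub0r scaleN1r addrC.
  move/eqP; rewrite subr_eq0 => /eqP <-; rewrite scaler_sumr.
  by apply: eq_bigr => j _; rewrite scalerA -fdalg_inM.
suff /n_min : `[< exists b', @spans n b' >] by rewrite ltnn.
apply/asboolP; exists (fun j => b (lift i j)) => m'.
have [c' ->] := bP m'.
exists (fun j => c' i * (- (e i)^-1 * e (lift i j)) + c' (lift i j)).
rewrite (bigD1 i) //= [in LHS]bi scaler_sumr -big_split /=.
rewrite (reindex_omap (lift i) (unlift i)) /=; last first.
  by move=> j; rewrite eq_sym => ji; have [j' -> ->] := unlift_some ji.
apply: eq_big => [j|j _]; first by rewrite liftK eqxx andbT eq_sym neq_lift.
by rewrite scalerA -scalerDl -fdalg_inM -fdalg_inD.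
Qed.

Lemma FA_essentially_surjective (M : rep) : exists U, module_iso (FA U) M.
Proof.
have [n [b bP]] := rep_basis M.
pose comb (c : Mk k 'I_n) : M := \sum_i fdalg_in A (c i) *: b i.
have [coord coordP] : exists coord : M -> Mk k 'I_n, forall m, m = comb (coord m).
  have ex_c m : exists c, m = comb c by have [c [mE _]] := bP m; exists c.
  by exists (fun m => sval (cid (ex_c m))) => m; exact: svalP (cid (ex_c m)).
have comb_inj : injective comb.
  move=> c d cd; have [e [_ eU]] := bP (comb c).
  by rewrite -(eU c) // -(eU d).
have combK : cancel comb coord by move=> c; apply: comb_inj; rewrite -coordP.
have combD c d : comb (c + d) = comb c + comb d.
  by rewrite -big_split; apply: eq_bigr => i _; rewrite ffunE fdalg_inD scalerDl.
have combZ (x : k) c : comb (x *: c) = fdalg_in A x *: comb c.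
  rewrite scaler_sumr; apply: eq_bigr => i _.
  by rewrite ffunE scalerA -fdalg_inM.
have comb0 : comb 0 = 0 by apply: (addrI (comb 0)); rewrite -combD !addr0.
have comb_sum (I : finType) (F : I -> Mk k 'I_n) :
    comb (\sum_i F i) = \sum_i comb (F i).
  exact: (big_morph comb combD comb0).
pose theta (a : A) : Hk k 'I_n := [ffun _ => [ffun p => coord (a *: b p.2) p.1]].
pose act a (v : Mk k 'I_n) : Mk k 'I_n :=
  [ffun i => \sum_j (theta a tt (i, j) : k) * v j].
have comb_act a v : comb (act a v) = a *: comb v.
  have -> : act a v = \sum_j (v j : k) *: coord (a *: b j).
    apply/ffunP => i; rewrite ffunE sum_ffunE; apply: eq_bigr => j _.
    by rewrite !ffunE mulrC.
  rewrite comb_sum scaler_sumr; apply: eq_bigr => j _.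
  by rewrite combZ -coordP !scalerA fdalg_inC.
have theta_eq (f g : Hk k 'I_n) :
    (forall v : Mk k 'I_n, [ffun i => \sum_j (f tt (i, j) : k) * v j]
       = [ffun i => \sum_j (g tt (i, j) : k) * v j] :> Mk k 'I_n) -> f = g.
  have sum_ret (F : 'I_n -> k) j : \sum_q F q * kl_ret k j q = F j.
    rewrite (bigD1 j) //= big1 => [|q qj].
      by rewrite ffunE eqxx mulr1 addr0.
    by rewrite ffunE (negPf qj) mulr0.
  move=> fg; apply: HkP => i j; have /ffunP/(_ i) := fg (kl_ret k j).
  by rewrite ffunE [in X in _ = X]ffunE !sum_ret.
have theta_lin : linear theta.
  move=> x a a'; apply: theta_eq => v; apply: comb_inj.
  rewrite comb_act.
  have -> : [ffun i => \sum_j ((x *: theta a + theta a') tt (i, j) : k) * v j]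
      = x *: act a v + act a' v.
    apply/ffunP => i; rewrite ffunE [RHS]ffunE [X in _ = X + _]ffunE.
    rewrite [act a v i]ffunE [act a' v i]ffunE scaler_sumr -big_split.
    by apply: eq_bigr => j _; rewrite !ffunE /GRing.scale /= mulrDl mulrA.
  by rewrite combD combZ !comb_act scalerA -scalerDl fdalg_inE.
have theta1 : theta 1 = 1.
  apply: theta_eq => v; apply: comb_inj; rewrite comb_act scale1r.
  congr comb; apply/ffunP => i; rewrite ffunE (bigD1 i) //= big1 => [|j ji].
    by rewrite Hk1E eqxx mul1r addr0.
  by rewrite Hk1E eq_sym (negPf ji) mul0r.
have thetaM : {morph theta : a a' / a * a'}.
  move=> a a'; apply: theta_eq => v; apply: comb_inj.
  rewrite comb_act -scalerA -!comb_act; congr comb; apply/ffunP => i.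
  rewrite [LHS]ffunE [RHS]ffunE.
  under eq_bigr do rewrite [act _ _ _]ffunE mulr_sumr.
  rewrite exchange_big; apply: eq_bigr => j _.
  by rewrite HkME mulr_suml; apply: eq_bigr => q _; rewrite mulrA.
pose thetaL := HB.pack_for {linear A -> Hk k 'I_n} theta
  (GRing.isLinear.Build _ _ _ _ theta theta_lin).
exists (@Klcrep 'I_n thetaL (theta1, thetaM)).
set U := Klcrep _.
have comb_lin : linear (comb : FA U -> M).
  move=> a u v; rewrite combD -comb_act; congr (comb _ + _).
  by apply/ffunP => i; rewrite [RHS]ffunE; exact: (@FA_scaleE U).
pose combL := HB.pack_for {linear FA U -> M} (comb : FA U -> M)
  (GRing.isLinear.Build _ _ _ _ (comb : FA U -> M) comb_lin).
by exists combL; exists coord => // m; rewrite -coordP.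
Qed.

(* "Simple" is predicated of nonzero objects only. *)
Definition simple_klcrep U : Prop := ~ klcrep_zero U /\ simple_module (FA U).

Definition FA_simple U (U_simple : simple_klcrep U) : simple_module (FA U) :=
  proj2 U_simple.

(* An isomorphism class is the predicate of being isomorphic to some given
   object. *)
Definition simple_klcrep_classes : Type :=
  {C : klcrep -> Prop | exists2 U, simple_klcrep U & C = klcrep_iso U}.

Definition simple_module_classes : Type :=
  {C : lmodType A -> Prop | exists2 M, simple_module M & C = module_iso M}.

Definition klcrep_class U (U_simple : simple_klcrep U) : simple_klcrep_classes :=
  exist _ (klcrep_iso U) (ex_intro2 _ _ U U_simple erefl).

Definition module_class (M : lmodType A) (M_simple : simple_module M) :
    simple_module_classes :=
  exist _ (module_iso M) (ex_intro2 _ _ M M_simple erefl).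

End Klcrep.

(* Main.v *)
From HB Require Import structures.
Require Import Defs.
From mathcomp Require Import all_boot all_order all_algebra.
From mathcomp Require Import boolp.

(** The functor FA is full, faithful and essentially surjective onto the
    finite-dimensional modules; the bijection follows formally from this once
    simple modules are known to be finite-dimensional, and the criterion
    identifies submodules with stable subspaces.

    For the bijection: a full and faithful functor preserves and reflects
    isomorphism ([klcrep_isoP]), so the class of U and the class of FA U
    determine each other. Every simple A-module M is finite-dimensional, because
    M = A m for any nonzero m in M ([simple_module_fin_dim]); hence M is
    isomorphic to some FA U, and U is then a simple object
    ([simple_module_lift]). The bijection and its inverse are written without
    choosing representatives: a class C of objects is sent to the modules
    isomorphic to FA U for some U in C, and a class D of modules is sent to the
    objects U such that FA U lies in D.

    For the criterion: the zero object is the one with zero module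
    ([klcrep_zeroPn]), and the submodules of FA U are the subspaces stable under
    all the operators Phi (theta a). Only the passage from a subset closed under
    linear combinations to a subspace given by a basis needs an argument, namely
    a choice of largest dimension ([vspace_of_linear_closed]). *)

Set Implicit Arguments.
Unset Strict Implicit.
Unset Printing Implicit Defensive.

Import GRing.Theory.
Local Open Scope ring_scope.

(** * Isomorphic modules *)

Section ModuleIso.
Variables (k : fieldType) (A : fdAlg k).
Implicit Types M N P : lmodType A.

Lemma module_iso_refl M : module_iso M M.
Proof. by exists idfun; exists idfun. Qed.

Lemma module_iso_sym M N : module_iso M N -> module_iso N M.
Proof.
case=> f [g fK gK].
pose gL := HB.pack_for {linear N -> M} g
  (GRing.isLinear.Build _ _ _ _ g (can2_linear fK gK)).
by exists gL; exists f.
Qed.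

Lemma module_iso_trans N M P :
  module_iso M N -> module_iso N P -> module_iso M P.
Proof. by move=> [f f_bij] [g g_bij]; exists (g \o f); exact: bij_comp. Qed.

Lemma module_iso_class_eq M N :
  module_iso M N -> module_iso M = module_iso N.
Proof.
move=> MN; apply/funext => P; apply/propext; split; last exact: module_iso_trans.
exact/module_iso_trans/module_iso_sym.
Qed.

Lemma simple_module_iso M N :
  module_iso M N -> simple_module M -> simple_module N.
Proof.
move=> [f [g fK gK]] [[m m0] Msub]; split.
  by exists (f m); rewrite raddf_eq0 //; exact: can_inj fK.
move=> S [S0 Slin].
have preS : submod_closed [pred x | f x \in S].
  by split=> [|a u v] /=; rewrite !inE ?linear0 // linearP; exact: Slin.
have gS y : (y \in S) = (g y \in [pred x | f x \in S]) by rewrite inE gK.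
case: (Msub _ preS) => SE; [left|right] => y; rewrite gS SE !inE //.
by rewrite -(inj_eq (can_inj fK)) gK linear0.
Qed.

(** For nonzero m, the orbit A m is a nonzero submodule, hence everything, and
    it is spanned by the products of a basis of A with m. *)
Lemma simple_module_fin_dim M : simple_module M -> fin_dim_module M.
Proof.
move=> [[m m0] Msub].
pose S : {pred M} := [pred x | `[< exists a : A, x = a *: m >]].
have S_closed : submod_closed S.
  split=> [|a u v]; rewrite !inE.
    by apply/asboolP; exists 0; rewrite scale0r.
  move=> /asboolP[b ->] /asboolP[c ->]; apply/asboolP; exists (a * b + c).
  by rewrite scalerDl scalerA.
(* The orbit is not zero, since it contains 1 *: m = m. *)
have orbit x : exists a : A, x = a *: m.
  case: (Msub S S_closed) => SE; last first.
    by have := SE x; rewrite !inE => /asboolP.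
  have := SE m; rewrite !inE (negPf m0) => /asboolP[].
  by exists 1; rewrite scale1r.
pose act (e : A) : M := e *: m.
pose b : seq A := vbasis {:fdalg_vect A}.
have sz : size [seq act e | e <- b] = \dim {:fdalg_vect A}.
  by rewrite size_map size_tuple.
exists [seq act e | e <- b] => x; have [a ->] := orbit x.
exists (fun i => coord (vbasis {:fdalg_vect A}) (cast_ord sz i) a).
rewrite (reindex (cast_ord (esym sz))) /=; last first.
  by apply: onW_bij; exists (cast_ord sz) => i; apply: val_inj.
have aE := coord_vbasis (memvf (a : fdalg_vect A)).
transitivity (act (\sum_(i < \dim {:fdalg_vect A})
    fdalg_in A (coord (vbasis {:fdalg_vect A}) i a) * b`_i)).
  congr act; rewrite [LHS]aE; apply: eq_bigr => i _; exact/esym/fdalg_inE.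
rewrite /act scaler_suml; apply: eq_bigr => i _.
rewrite cast_ordKV (nth_map (0 : A)) ?size_tuple ?ltn_ord //.
by rewrite -scalerA.
Qed.

End ModuleIso.

(** * Isomorphic objects and the zero object *)

Section Objects.
Variables (k : fieldType) (A : fdAlg k).
Implicit Types U V : klcrep A.

(** A full and faithful functor reflects isomorphisms: fullness lifts the two
    module maps, faithfulness lifts the two identities between them. *)
Lemma klcrep_isoP U V : klcrep_iso U V <-> module_iso (FA U) (FA V).
Proof.
split=> [[f [g [fhom ghom gf fg]]]|[f [g fK gK]]].
  pose fL := HB.pack_for {linear FA U -> FA V} (@FA_mor k A U V f)
    (GRing.isLinear.Build _ _ _ _ (@FA_mor k A U V f) ((is_klhomP f).1 fhom)).
  exists fL; exists (@FA_mor k A V U g) => v /=.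
    by rewrite -FA_mor_comp gf FA_mor_id.
  by rewrite -FA_mor_comp fg FA_mor_id.
pose gL := HB.pack_for {linear FA V -> FA U} g
  (GRing.isLinear.Build _ _ _ _ g (can2_linear fK gK)).
have [f' f'hom f'E] := FA_mor_full f.
have [g' g'hom g'E] := FA_mor_full gL.
exists f', g'; split=> //.
  apply: (@FA_mor_faithful k A U U) => v.
  by rewrite FA_mor_comp FA_mor_id f'E g'E; exact: fK.
apply: (@FA_mor_faithful k A V V) => v.
by rewrite FA_mor_comp FA_mor_id g'E f'E; exact: gK.
Qed.

(** On a zero object the identity and the zero arrow coincide, which forces the
    module to vanish; conversely all arrows from or to an object with zero
    module are zero, by faithfulness. *)
Lemma klcrep_zeroPn U : ~ klcrep_zero U <-> exists m : FA U, m != 0.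
Proof.
have mor0 V W (v : FA V) : @FA_mor k A V W 0 v = 0.
  by apply/ffunP => y; rewrite FA_morE !ffunE big1 // => x _; rewrite !ffunE mulr0.
have hom0 V W : @is_klhom k A V W 0.
  by apply/is_klhomP => a u v; rewrite !mor0 scaler0 addr0.
split=> [U0|[m m0] U0]; last first.
  have [[f [_ f_unique]] _] := U0 U.
  have id0 : kl_id k (kl_set U) = 0.
    by rewrite -(f_unique _ (is_klhom_id U)) (f_unique _ (hom0 U U)).
  by move: m0; rewrite -[m]FA_mor_id id0 mor0 eqxx.
apply: contrapT => nz; apply: U0 => V.
have U_trivial (v : FA U) : v = 0.
  by apply/eqP/contraT => v0; case: nz; exists v.
split; exists 0; split=> [|f _]; try exact: hom0.
  apply: FA_mor_faithful => v; rewrite (U_trivial v) mor0.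
  by apply/ffunP => y; rewrite FA_morE ffunE big1 // => x _; rewrite ffunE mul0r.
by apply: FA_mor_faithful => v; rewrite mor0 (U_trivial (FA_mor f v)).
Qed.

Lemma simple_klcrepP U : simple_klcrep U <-> simple_module (FA U).
Proof.
split=> [[] //|U_simple]; split=> //; apply/klcrep_zeroPn.
exact: U_simple.1.
Qed.

(** A simple module is finite-dimensional, so essential surjectivity reaches it,
    and simplicity passes back along the isomorphism. *)
Lemma simple_module_lift (M : lmodType A) :
  simple_module M -> exists2 U : klcrep A, simple_klcrep U & module_iso (FA U) M.
Proof.
move=> M_simple.
have [U UM] := FA_essentially_surjective (Rep (simple_module_fin_dim M_simple)).
exists U => //; apply/simple_klcrepP.
exact: simple_module_iso (module_iso_sym UM) M_simple.
Qed.

End Objects.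

(** * The bijection on isomorphism classes *)

Section Classes.
Variables (k : fieldType) (A : fdAlg k).

Lemma sval_inj T (P : T -> Prop) : injective (@sval T P).
Proof. by move=> [x Px] [y Py] /= xy; exact: eq_exist. Qed.

Lemma FA_class_eq (U : klcrep A) :
  (fun M => exists2 V, klcrep_iso U V & module_iso (FA V) M) = module_iso (FA U).
Proof.
apply/funext => M; apply/propext; split=> [[V /klcrep_isoP UV]|UM].
  exact: module_iso_trans.
by exists U => //; apply/klcrep_isoP; exact: module_iso_refl.
Qed.

Lemma FA_class_subproof (C : simple_klcrep_classes A) :
  exists2 M, simple_module M &
    (fun M => exists2 U, sval C U & module_iso (FA U) M) = module_iso M.
Proof.
case: C => C [U U_simple CE] /=; exists (FA U); first by case: U_simple.
by rewrite CE FA_class_eq.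
Qed.

Definition FA_class (C : simple_klcrep_classes A) : simple_module_classes A :=
  exist _ _ (FA_class_subproof C).

Lemma FA_preclass_eq (U : klcrep A) (M : lmodType A) :
  module_iso (FA U) M -> (fun V => module_iso M (FA V)) = klcrep_iso U.
Proof.
move=> UM; apply/funext => V; apply/propext.
by rewrite klcrep_isoP (module_iso_class_eq UM).
Qed.

Lemma FA_preclass_subproof (D : simple_module_classes A) :
  exists2 U, simple_klcrep U & (fun U : klcrep A => sval D (FA U)) = klcrep_iso U.
Proof.
case: D => D [M /simple_module_lift[U U_simple UM] DE] /=.
by exists U => //; rewrite DE; exact: FA_preclass_eq.
Qed.

Definition FA_preclass (D : simple_module_classes A) : simple_klcrep_classes A :=
  exist _ _ (FA_preclass_subproof D).

Lemma FA_class_bij : bijective FA_class.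
Proof.
exists FA_preclass => [C|D]; apply: sval_inj.
  have [U _ CE] := svalP C.
  have FAC : sval (FA_class C) = module_iso (FA U) by rewrite /= CE FA_class_eq.
  transitivity (fun V : klcrep A => sval (FA_class C) (FA V)) => //.
  by rewrite FAC CE; exact: FA_preclass_eq (module_iso_refl _).
have [M M_simple DE] := svalP D; have [U _ UM] := simple_module_lift M_simple.
have preD : sval (FA_preclass D) = klcrep_iso U.
  by rewrite /= DE; exact: FA_preclass_eq.
by rewrite DE -(module_iso_class_eq UM) -FA_class_eq -preD.
Qed.

Lemma FA_class_klcrep_class (U : klcrep A) (U_simple : simple_klcrep U) :
  FA_class (klcrep_class U_simple) = module_class (FA_simple U_simple).
Proof. by apply: sval_inj; exact: FA_class_eq. Qed.

End Classes.

(** * Submodules as stable subspaces *)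

(** A subspace of largest dimension among those contained in S exhausts S,
    since adjoining a vector of S to it keeps it inside S. *)
Lemma vspace_of_linear_closed (k : fieldType) (V : vectType k) (S : {pred V}) :
  submod_closed S -> exists W : {vspace V}, W =i S.
Proof.
move=> [S0 Slin].
pose P n := `[< exists2 W : {vspace V}, \dim W = n & {subset W <= S} >].
have exP : exists n, P n.
  exists 0; apply/asboolP; exists 0%VS; first exact: dimv0.
  by move=> w; rewrite memv0 => /eqP->.
have boundP n : P n -> (n <= \dim {:V})%N.
  by move=> /asboolP[W <- _]; exact/dimvS/subvf.
case: (ex_maxnP exP boundP) => n /asboolP[W Wn WS] n_max.
exists W => v; apply/idP/idP => [/WS//|vS].
have WvS : {subset (W + <[v]>)%VS <= S}.
  move=> _ /memv_addP[w wW [_ /vlineP[c ->] ->]].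
  by rewrite addrC; apply: Slin => //; exact: WS.
have le_dim : (\dim (W + <[v]>) <= \dim W)%N.
  by rewrite Wn; apply: n_max; apply/asboolP; exists (W + <[v]>)%VS.
have /eqP -> : W == (W + <[v]>)%VS.
  by rewrite -(geq_leqif (dimv_leqif_eq (addvSl W <[v]>%VS))).
by apply: subvP (memv_line v); exact: addvSr.
Qed.

(** The scalars of k act on FA U through multiples of the unit of A, so that a
    submodule is in particular closed under k-linear combinations. *)
Lemma FA_submodule_vspace (k : fieldType) (A : fdAlg k) (U : klcrep A)
    (S : {pred FA U}) :
  submod_closed S -> exists W : {vspace Mk k (kl_set U)}, W =i S.
Proof.
move=> [S0 Slin]; apply: vspace_of_linear_closed; split=> // c u v uS vS.
by rewrite -(FA_scalarE c (u : FA_sort U)); exact: Slin.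
Qed.

Lemma simple_FA_stableP (k : fieldType) (A : fdAlg k) (U : klcrep A) :
  ~ klcrep_zero U ->
  simple_klcrep U <->
  forall W : {vspace Mk k (kl_set U)},
    (forall (a : A) (w : Mk k (kl_set U)),
       w \in W -> Mk_mx (Phi (kl_rep U a)) w \in W) ->
    W = 0%VS \/ W = fullv.
Proof.
move=> U0; split=> [[_ [_ Usub]] W Wstable|Ustable].
  pose S : {pred FA U} := [pred v : FA U | (v : Mk k (kl_set U)) \in W].
  have S_closed : submod_closed S.
    split=> [|a u v uW vW]; first exact: (mem0v W).
    exact: (memvD (Wstable a _ uW) vW).
  case: (Usub S S_closed) => SE; [left|right]; apply/vspaceP => v.
    by rewrite memv0; exact: SE.
  by rewrite memvf; exact: SE.
split=> //; split; first exact/klcrep_zeroPn.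
move=> S S_closed; have [W WS] := FA_submodule_vspace S_closed.
have [S0 Slin] := S_closed.
have Wstable (a : A) (w : Mk k (kl_set U)) :
    w \in W -> Mk_mx (Phi (kl_rep U a)) w \in W.
  by rewrite !WS => wS; have := Slin a w 0 wS S0; rewrite addr0.
case: (Ustable W Wstable) => WE; [left|right] => v; rewrite -WS WE.
  by rewrite memv0.
by rewrite memvf.
Qed.

Theorem proposition6p11 (k : fieldType) (A : fdAlg k) :
  (exists phi : simple_klcrep_classes A -> simple_module_classes A,
      (forall (U : klcrep A) (U_simple : simple_klcrep U),
         phi (klcrep_class U_simple) = module_class (FA_simple U_simple)) /\
      bijective phi) /\
  (forall U : klcrep A, ~ klcrep_zero U ->
     (simple_klcrep U <->
      forall W : {vspace Mk k (kl_set U)},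
        (forall (a : A) (w : Mk k (kl_set U)),
           w \in W -> Mk_mx (Phi (kl_rep U a)) w \in W) ->
        W = 0%VS \/ W = fullv)).
Proof.
split; last exact: simple_FA_stableP.
exists (@FA_class k A); split; last exact: FA_class_bij.
exact: FA_class_klcrep_class.
Qed.
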